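(* (Generalized Snell's law.) Let $s_1,s_2>0$ be real, let $\mu\in\mathbb{C}\setminus\{0\}$, and let $S(z)=s_1$ for $\mathrm{Im}\,z<0$ and $S(z)=s_2$ for $\mathrm{Im}\,z\ge 0$. Consider a pair of poles $z,z'$ with strengths $-\mu S(z)$ and $+\mu S(z')$, arriving from the lower half-plane: before time $0$ both poles lie in the lower half-plane $\mathrm{Im}<0$; at time $0$ the pole $z'$ crosses the real axis, so $\mathrm{Im}\,z'(0)=0$, while $\mathrm{Im}\,z(0)<0$; during the times strictly between $0$ and some $t>0$ the pole $z'$ is in the upper half-plane and $z$ is still in the lower half-plane; and at time $t$ the pole $z$ crosses the real axis, $\mathrm{Im}\,z(t)=0$, after which both poles move in the upper half-plane. Let $\theta_1$ and $\theta_2$ be the angles of incidence pre- and post-crossing. Then $$s_1\sin\theta_1\,\exp\Bigl(-\frac{\mathrm{Re}\,\mu}{\mathrm{Im}\,\mu}\,\theta_1\Bigr)=s_2\sin\theta_2\,\exp\Bigl(-\frac{\mathrm{Re}\,\mu}{\mathrm{Im}\,\mu}\,\theta_2\Bigr)\qquad\text{if }\mathrm{Im}\,\mu\neq0,$$ and $$\theta_1=\theta_2\qquad\text{if }\mathrm{Im}\,\mu=0.$$ In particular, if $\mu$ is pure imaginary, then $s_1\sin\theta_1=s_2\sin\theta_2$.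
   Context: The bar denotes complex conjugation. The pair moves according to $$\frac{d}{dt}z=\frac{\overline{\mu}\,S(z')}{\overline{z}-\overline{z'}},\qquad \frac{d}{dt}z'=\frac{-\overline{\mu}\,S(z)}{\overline{z'}-\overline{z}},$$ where the trajectories are continuous in time and satisfy the equations on each time interval during which neither pole crosses the discontinuity line $\mathrm{Im}\,z=0$ of $S$. While both poles are in the same half-plane they move along parallel straight lines with $z'-z$ constant. The angles of incidence are $\theta_1=\arg(z'-z)$ before the crossing (equivalently $\theta_1=\arg(z'(0)-z(0))$) and $\theta_2=\arg(z'-z)$ after the crossing (equivalently $\theta_2=\arg(z'(t)-z(t))$), the argument being measured from the positive real axis and continuously along the motion, with values in $(0,\pi)$. (For $\mu$ pure imaginary the velocity is perpendicular to $z'-z$, so $\theta_1,\theta_2$ are then the angles between the trajectories and the normal to the real axis.) *)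

(* Defs.v *)
From Stdlib Require Import Reals.
From Coquelicot Require Import Coquelicot.
Open Scope R_scope.

Definition lower_half_plane (p : C) : Prop := Im p < 0.
Definition upper_half_plane (p : C) : Prop := 0 < Im p.
Definition real_axis (p : C) : Prop := Im p = 0.

Definition two_media (s1 s2 : R) (p : C) : R :=
  if Rlt_dec (Im p) 0 then s1 else s2.

(* [z] has strength [- mu * S z] and [z'] has strength [mu * S z'].  The set on
   which [S] is discontinuous is the real axis; the equations of motion are
   imposed only on open time intervals during which both poles stay off it, and
   the pieces are glued by continuity. *)
Definition pole_pair_motion (S : C -> R) (mu : C) (a b : R) (z z' : R -> C) :
    Prop :=
  (forall tau, a < tau < b -> continuous z tau /\ continuous z' tau) /\
  (forall c d, a <= c -> d <= b ->
    (forall tau, c < tau < d -> ~ real_axis (z tau) /\ ~ real_axis (z' tau)) ->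
    forall tau, c < tau < d ->
      @is_derive R_AbsRing C_R_NormedModule z tau
        (Cconj mu * RtoC (S (z' tau)) /
           (Cconj (z tau) - Cconj (z' tau)))%C /\
      @is_derive R_AbsRing C_R_NormedModule z' tau
        (- Cconj mu * RtoC (S (z tau)) /
           (Cconj (z' tau) - Cconj (z tau)))%C).

(* [z'] enters the upper half-plane at time [0] and [z] follows at time [t]. *)
Definition crosses_from_below (a b t : R) (z z' : R -> C) : Prop :=
  (forall tau, a < tau < 0 ->
     lower_half_plane (z tau) /\ lower_half_plane (z' tau)) /\
  (real_axis (z' 0) /\ lower_half_plane (z 0)) /\
  (forall tau, 0 < tau < t ->
     upper_half_plane (z' tau) /\ lower_half_plane (z tau)) /\
  real_axis (z t) /\
  (forall tau, t < tau < b ->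
     upper_half_plane (z tau) /\ upper_half_plane (z' tau)).

Definition is_arg (w : C) (theta : R) : Prop :=
  w <> 0%C /\ w = (Cmod w * cos theta, Cmod w * sin theta).

Definition angle_along (a b : R) (w : R -> C) (theta : R -> R) : Prop :=
  forall tau, a < tau < b ->
    is_arg (w tau) (theta tau) /\ 0 < theta tau < PI /\ continuous theta tau.

(* Main.v *)
Require Import Defs.
From Stdlib Require Import Reals.
From Coquelicot Require Import Coquelicot.
From Stdlib Require Import Lra.
Open Scope R_scope.

(** Write [w = z' - z] and [V = conj mu / conj w].  While the two poles stay off
    the real axis the equations of motion read [dz/dt = - S(z') V] and
    [dz'/dt = - S(z) V] with [S(z)], [S(z')] frozen, so two quantities are
    conserved on every such phase.

    The first is [S(z) z - S(z') z'], of which only the imaginary part is used.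
    In the phases before and after the crossings the two strengths agree and
    [Im w] is constant.  Between the crossings it says that
    [s1 Im z - s2 Im z'] takes the same value at time [0], where
    [Im z' = 0] and [Im w = - Im z], as at time [t], where [Im z = 0] and
    [Im w = Im z'].  Hence [s1 Im w] before the crossing equals [s2 Im w]
    after it.

    The second is the imaginary part of [mu log w], that is
    [Re mu * theta + Im mu * ln |w|]: since [dw/dt = (S(z') - S(z)) V], the
    derivative of [mu log w] is [(S(z') - S(z)) |mu|^2 / |w|^2], which is real.
    Being continuous, it is the same number before and after the crossings.

    Since [Im w = |w| sin theta], eliminating [|w|] between the two conservation
    laws gives the law of refraction; when [Im mu = 0] the second one alone says
    that [theta] does not change. *)

(** * Calculus for real and complex functions of time *)

Lemma eq_of_zero_derivative (f : R -> R) (p q : R) :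
  p <= q ->
  (forall x, p < x < q -> is_derive f x 0) ->
  (forall x, p <= x <= q -> continuous f x) ->
  f p = f q.
Proof.
  intros Hpq Hd Hc.
  destruct (MVT_gen f p q (fun _ => 0)) as [c [_ Hf]].
  - intros x. rewrite Rmin_left, Rmax_right by lra. apply Hd.
  - intros x. rewrite Rmin_left, Rmax_right by lra. intros Hx.
    apply continuity_pt_filterlim. apply (Hc x Hx).
  - lra.
Qed.

Lemma is_derive_Re (f : R -> C) (x : R) (l : C) :
  @is_derive R_AbsRing C_R_NormedModule f x l ->
  is_derive (fun y => Re (f y)) x (Re l).
Proof.
  intros H.
  apply (filterdiff_comp' f (fun p : C => fst p) x (fun y : R => @scal R_AbsRing C_R_NormedModule y l)
           (fun p : C => fst p)).
  - exact H.
  - apply filterdiff_linear. exact is_linear_fst.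
Qed.

Lemma is_derive_Im (f : R -> C) (x : R) (l : C) :
  @is_derive R_AbsRing C_R_NormedModule f x l ->
  is_derive (fun y => Im (f y)) x (Im l).
Proof.
  intros H.
  apply (filterdiff_comp' f (fun p : C => snd p) x (fun y : R => @scal R_AbsRing C_R_NormedModule y l)
           (fun p : C => snd p)).
  - exact H.
  - apply filterdiff_linear. exact is_linear_snd.
Qed.

Lemma continuous_Re (f : R -> C) (x : R) :
  continuous f x -> continuous (fun y => Re (f y)) x.
Proof.
  intros H. apply (continuous_comp f (fun p : C => fst p) x H).
  apply continuous_fst.
Qed.

Lemma continuous_Im (f : R -> C) (x : R) :
  continuous f x -> continuous (fun y => Im (f y)) x.
Proof.
  intros H. apply (continuous_comp f (fun p : C => snd p) x H).
  apply continuous_snd.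
Qed.

(** * The imaginary part of [mu log w] *)

(** The inverse cotangent, unlike [is_arg] itself, gives a formula for the angle
    that can be differentiated. *)
Lemma is_arg_upper (w : C) (theta : R) :
  is_arg w theta -> 0 < theta < PI ->
  Im w = Cmod w * sin theta /\ 0 < Im w /\
  theta = PI / 2 - atan (Re w / Im w).
Proof.
  intros [Hw0 Hw] Ht.
  assert (Hm : 0 < Cmod w) by (apply Cmod_gt_0; exact Hw0).
  assert (Hs : 0 < sin theta) by (apply sin_gt_0; lra).
  assert (HR : Re w = Cmod w * cos theta) by (rewrite Hw at 1; reflexivity).
  assert (HI : Im w = Cmod w * sin theta) by (rewrite Hw at 1; reflexivity).
  split; [exact HI|]. split; [rewrite HI; apply Rmult_lt_0_compat; assumption|].
  rewrite HR, HI.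
  replace (Cmod w * cos theta / (Cmod w * sin theta)) with (tan (PI / 2 - theta)).
  - rewrite atan_tan; lra.
  - unfold tan. rewrite sin_shift, cos_shift. field. lra.
Qed.

(** [Im (mu * log (x + i y))] for [y > 0]. *)
Definition im_mu_log (mu : C) (x y : R) : R :=
  Re mu * (PI / 2 - atan (x / y)) + Im mu * ln (sqrt (x ^ 2 + y ^ 2)).

Lemma continuous_im_mu_log (mu : C) (x y : R -> R) (tau : R) :
  0 < y tau -> continuous x tau -> continuous y tau ->
  continuous (fun s => im_mu_log mu (x s) (y s)) tau.
Proof.
  intros Hy Cx Cy.
  assert (Hn : 0 < x tau ^ 2 + y tau ^ 2) by nra.
  assert (Hl : 0 < sqrt (x tau ^ 2 + y tau ^ 2)) by (apply sqrt_lt_R0; exact Hn).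
  apply (@continuous_plus _ R_AbsRing R_NormedModule).
  - apply (@continuous_scal_r _ R_AbsRing R_NormedModule).
    apply (@continuous_minus _ R_AbsRing R_NormedModule);
      [apply continuous_const|].
    apply (continuous_comp (fun s => x s / y s) atan).
    + apply (@continuous_mult _ R_AbsRing x (fun s => / y s)); [exact Cx|].
      apply (continuous_comp y Rinv); [exact Cy|].
      apply continuous_Rinv. lra.
    + apply (@ex_derive_continuous R_AbsRing R_NormedModule).
      auto_derive. exact I.
  - apply (@continuous_scal_r _ R_AbsRing R_NormedModule).
    apply (continuous_comp (fun s => x s ^ 2 + y s ^ 2) (fun u => ln (sqrt u))).
    + apply (@continuous_plus _ R_AbsRing R_NormedModule).
      * apply (continuous_comp x (fun u => u ^ 2)); [exact Cx|].
        apply (@ex_derive_continuous R_AbsRing R_NormedModule).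
        auto_derive. exact I.
      * apply (continuous_comp y (fun u => u ^ 2)); [exact Cy|].
        apply (@ex_derive_continuous R_AbsRing R_NormedModule).
        auto_derive. exact I.
    + apply (@ex_derive_continuous R_AbsRing R_NormedModule).
      auto_derive. auto.
Qed.

(** The hypotheses say [dw/dt = k * conj mu / conj w] for [w = x + i y] and a
    real [k]; then [mu * dw/dt / w] is real. *)
Lemma is_derive_im_mu_log (mu : C) (x y : R -> R) (k tau : R) :
  0 < y tau ->
  is_derive x tau
    (k * ((Re mu * x tau + Im mu * y tau) / (x tau ^ 2 + y tau ^ 2))) ->
  is_derive y tau
    (k * ((Re mu * y tau - Im mu * x tau) / (x tau ^ 2 + y tau ^ 2))) ->
  is_derive (fun s => im_mu_log mu (x s) (y s)) tau 0.
Proof.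
  intros Hy Dx Dy.
  assert (Hn : 0 < x tau ^ 2 + y tau ^ 2) by nra.
  assert (Hl : 0 < sqrt (x tau ^ 2 + y tau ^ 2)) by (apply sqrt_lt_R0; exact Hn).
  unfold im_mu_log.
  auto_derive.
  - repeat split; try (eexists; eassumption); try lra; simpl in *; try assumption.
  - change (Derive (fun s => x s) tau) with (Derive x tau).
    change (Derive (fun s => y s) tau) with (Derive y tau).
    rewrite (is_derive_unique x tau _ Dx), (is_derive_unique y tau _ Dy).
    change (x tau * (x tau * 1) + y tau * (y tau * 1))
      with (x tau ^ 2 + y tau ^ 2).
    set (r := sqrt (x tau ^ 2 + y tau ^ 2)) in *.
    assert (Hr : r * r = x tau ^ 2 + y tau ^ 2) by (apply sqrt_sqrt; lra).
    rewrite (Rmult_assoc _ (/ (2 * r)) (/ r)).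
    replace (/ (2 * r) * / r) with (/ (2 * (x tau ^ 2 + y tau ^ 2)))
      by (rewrite <- Hr; field; lra).
    field. split; nra.
Qed.

(** * Conservation laws of the motion *)

(** Both equations of motion have the shape [- s * V] with the same
    [V = conj mu / conj w = conj mu * w / |w|^2], because exchanging the poles
    changes the sign of [w] and the sign of the strength. *)
Lemma velocity_components (mu z z' : C) (s : R) :
  0 < Im (z' - z)%C ->
  let x := Re (z' - z)%C in
  let y := Im (z' - z)%C in
  let v := (Cconj mu * RtoC s / (Cconj z - Cconj z'))%C in
  let v' := (- Cconj mu * RtoC s / (Cconj z' - Cconj z))%C in
  Re v = - s * ((Re mu * x + Im mu * y) / (x ^ 2 + y ^ 2)) /\
  Im v = - s * ((Re mu * y - Im mu * x) / (x ^ 2 + y ^ 2)) /\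
  v' = v.
Proof.
  destruct mu as [m n], z as [u v], z' as [u' v']. simpl. intros Hy.
  assert (Hu := pow2_ge_0 (u' - u)).
  assert (Hv := Rmult_lt_0_compat _ _ Hy Hy).
  unfold Cdiv, Cmult, Cinv, Cminus, Cplus, Copp, Cconj, RtoC; simpl.
  split; [|split].
  - field. apply Rgt_not_eq; nra.
  - field. apply Rgt_not_eq; nra.
  - f_equal; field; repeat split; apply Rgt_not_eq; nra.
Qed.

(** The two conservation laws, on a time interval inside which the poles stay
    off the real axis; its endpoints may be crossing times. *)
Lemma conserved_on_phase (S : C -> R) (mu : C) (a b : R) (z z' : R -> C)
    (sg sg' p q : R) :
  pole_pair_motion S mu a b z z' ->
  (forall tau, a < tau < b -> 0 < Im (z' tau - z tau)%C) ->
  a < p -> p <= q -> q < b ->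
  (forall tau, p < tau < q ->
     (~ real_axis (z tau) /\ ~ real_axis (z' tau)) /\
     S (z tau) = sg /\ S (z' tau) = sg') ->
  let L tau :=
    im_mu_log mu (Re (z' tau - z tau)%C) (Im (z' tau - z tau)%C) in
  sg * Im (z p) - sg' * Im (z' p) = sg * Im (z q) - sg' * Im (z' q) /\
  L p = L q.
Proof.
  intros [Hcont Hode] Hup Hap Hpq Hqb Hph L.
  assert (Hd : forall tau, p < tau < q ->
    let x := Re (z' tau - z tau)%C in
    let y := Im (z' tau - z tau)%C in
    let vx := (Re mu * x + Im mu * y) / (x ^ 2 + y ^ 2) in
    let vy := (Re mu * y - Im mu * x) / (x ^ 2 + y ^ 2) in
    (is_derive (fun s => Re (z s)) tau (- sg' * vx) /\
     is_derive (fun s => Im (z s)) tau (- sg' * vy)) /\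
    (is_derive (fun s => Re (z' s)) tau (- sg * vx) /\
     is_derive (fun s => Im (z' s)) tau (- sg * vy))).
  { intros tau Ht x y vx vy.
    destruct (Hph tau Ht) as [_ [Hs Hs']].
    destruct (Hode p q (Rlt_le _ _ Hap) (Rlt_le _ _ Hqb)
                (fun u Hu => proj1 (Hph u Hu)) tau Ht) as [D D'].
    assert (Hy : 0 < Im (z' tau - z tau)%C) by (apply Hup; lra).
    rewrite Hs' in D. rewrite Hs in D'.
    destruct (velocity_components mu (z tau) (z' tau) sg' Hy) as [E1 [E2 _]].
    destruct (velocity_components mu (z tau) (z' tau) sg Hy) as [E3 [E4 E5]].
    cbv zeta in E1, E2, E3, E4, E5. rewrite E5 in D'.
    unfold vx, vy, x, y. rewrite <- E1, <- E2, <- E3, <- E4.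
    auto using is_derive_Re, is_derive_Im. }
  assert (Hc : forall tau, p <= tau <= q ->
    (continuous (fun s => Re (z s)) tau /\ continuous (fun s => Im (z s)) tau) /\
    (continuous (fun s => Re (z' s)) tau /\ continuous (fun s => Im (z' s)) tau)).
  { intros tau Ht. destruct (Hcont tau) as [K K']; [lra|].
    auto using continuous_Re, continuous_Im. }
  split.
  - apply (eq_of_zero_derivative
             (fun s => sg * Im (z s) - sg' * Im (z' s)) p q Hpq).
    + intros tau Ht. destruct (Hd tau Ht) as [[_ D] [_ D']].
      evar_last.
      * apply (@is_derive_minus R_AbsRing R_NormedModule);
          apply is_derive_scal; eassumption.
      * unfold minus, plus, opp; simpl. ring.
    + intros tau Ht. destruct (Hc tau Ht) as [[_ K] [_ K']].
      apply (@continuous_minus _ R_AbsRing R_NormedModule);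
        apply (@continuous_scal_r _ R_AbsRing R_NormedModule); assumption.
  - apply (eq_of_zero_derivative L p q Hpq).
    + intros tau Ht. destruct (Hd tau Ht) as [[Dx Dy] [Dx' Dy']].
      apply (is_derive_im_mu_log mu (fun s => Re (z' s - z s)%C)
               (fun s => Im (z' s - z s)%C) (sg' - sg) tau).
      * apply Hup. lra.
      * evar_last.
        -- apply (@is_derive_minus R_AbsRing R_NormedModule); eassumption.
        -- unfold minus, plus, opp; simpl. ring.
      * evar_last.
        -- apply (@is_derive_minus R_AbsRing R_NormedModule); eassumption.
        -- unfold minus, plus, opp; simpl. ring.
    + intros tau Ht. destruct (Hc tau Ht) as [[Kx Ky] [Kx' Ky']].
      apply (continuous_im_mu_log mu (fun s => Re (z' s - z s)%C)
               (fun s => Im (z' s - z s)%C)).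
      * apply Hup. lra.
      * apply (@continuous_minus _ R_AbsRing R_NormedModule); assumption.
      * apply (@continuous_minus _ R_AbsRing R_NormedModule); assumption.
Qed.

Lemma two_media_lower (s1 s2 : R) (p : C) :
  lower_half_plane p -> ~ real_axis p /\ two_media s1 s2 p = s1.
Proof.
  unfold lower_half_plane, real_axis, two_media. intros H.
  split; [lra|]. destruct (Rlt_dec (Im p) 0); [reflexivity|contradiction].
Qed.

Lemma two_media_upper (s1 s2 : R) (p : C) :
  upper_half_plane p -> ~ real_axis p /\ two_media s1 s2 p = s2.
Proof.
  unfold upper_half_plane, real_axis, two_media. intros H.
  split; [lra|]. destruct (Rlt_dec (Im p) 0); [lra|reflexivity].
Qed.

Lemma im_mu_log_is_arg (mu w : C) (theta : R) :
  is_arg w theta -> 0 < theta < PI ->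
  im_mu_log mu (Re w) (Im w) = Re mu * theta + Im mu * ln (Cmod w).
Proof.
  intros Hw Ht. destruct (is_arg_upper w theta Hw Ht) as [_ [_ E]].
  unfold im_mu_log. rewrite <- E. reflexivity.
Qed.

(** * The law of refraction *)

(** Here [m + i n = mu] and [r = |w|].  Conservation of [m theta + n ln r] makes
    [exp (- (m / n) theta)] a fixed multiple of [r], so it can take the place
    of [r] in [s r sin theta]. *)
Lemma eliminate_modulus (s1 s2 m n r1 r2 theta1 theta2 : R) :
  0 < r1 -> 0 < r2 -> n <> 0 ->
  s1 * (r1 * sin theta1) = s2 * (r2 * sin theta2) ->
  m * theta1 + n * ln r1 = m * theta2 + n * ln r2 ->
  s1 * sin theta1 * exp (- (m / n) * theta1) =
  s2 * sin theta2 * exp (- (m / n) * theta2).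
Proof.
  intros H1 H2 Hn Hsin Hlog.
  set (K := (m * theta1 + n * ln r1) / n).
  assert (E1 : exp (- (m / n) * theta1) = r1 * exp (- K)).
  { rewrite <- (exp_ln r1 H1) at 1. rewrite <- exp_plus. f_equal.
    unfold K. field. exact Hn. }
  assert (E2 : exp (- (m / n) * theta2) = r2 * exp (- K)).
  { rewrite <- (exp_ln r2 H2) at 1. rewrite <- exp_plus. f_equal.
    unfold K. rewrite Hlog. field. exact Hn. }
  rewrite E1, E2.
  transitivity (s1 * (r1 * sin theta1) * exp (- K)); [ring|].
  rewrite Hsin. ring.
Qed.

Theorem mainTheorem4 (s1 s2 : R) (mu : C) (a b t : R) (z z' : R -> C)
    (theta : R -> R) (t1 t2 : R) :
  0 < s1 -> 0 < s2 -> mu <> 0%C ->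
  a < 0 -> 0 < t -> t < b ->
  pole_pair_motion (two_media s1 s2) mu a b z z' ->
  crosses_from_below a b t z z' ->
  angle_along a b (fun tau => (z' tau - z tau)%C) theta ->
  a < t1 <= 0 -> t <= t2 < b ->
  let theta1 := theta t1 in
  let theta2 := theta t2 in
  (Im mu <> 0 ->
     s1 * sin theta1 * exp (- (Re mu / Im mu) * theta1) =
     s2 * sin theta2 * exp (- (Re mu / Im mu) * theta2)) /\
  (Im mu = 0 -> theta1 = theta2) /\
  (Re mu = 0 -> s1 * sin theta1 = s2 * sin theta2).
Proof.
  intros Hs1 Hs2 Hmu Ha Ht Hb Hmot [Hbefore [[Hz'0 _] [Hmid [Hzt Hafter]]]]
    Hang Ht1 Ht2 theta1 theta2.
  assert (Hup : forall tau, a < tau < b -> 0 < Im (z' tau - z tau)%C).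
  { intros tau Htau. destruct (Hang tau Htau) as [Hw [Hr _]].
    apply (is_arg_upper _ _ Hw Hr). }
  destruct (conserved_on_phase _ mu a b z z' s1 s1 t1 0 Hmot Hup)
    as [I1 L1]; try lra.
  { intros tau Htau. destruct (Hbefore tau) as [Hz Hz']; [lra|].
    pose proof (two_media_lower s1 s2 _ Hz).
    pose proof (two_media_lower s1 s2 _ Hz'). tauto. }
  destruct (conserved_on_phase _ mu a b z z' s1 s2 0 t Hmot Hup)
    as [I2 L2]; try lra.
  { intros tau Htau. destruct (Hmid tau Htau) as [Hz' Hz].
    pose proof (two_media_lower s1 s2 _ Hz).
    pose proof (two_media_upper s1 s2 _ Hz'). tauto. }
  destruct (conserved_on_phase _ mu a b z z' s2 s2 t t2 Hmot Hup)
    as [I3 L3]; try lra.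
  { intros tau Htau. destruct (Hafter tau) as [Hz Hz']; [lra|].
    pose proof (two_media_upper s1 s2 _ Hz).
    pose proof (two_media_upper s1 s2 _ Hz'). tauto. }
  unfold real_axis in Hz'0, Hzt. rewrite Hz'0 in I1, I2. rewrite Hzt in I2, I3.
  assert (HI : s1 * Im (z' t1 - z t1)%C = s2 * Im (z' t2 - z t2)%C).
  { change (s1 * (Im (z' t1) - Im (z t1)) = s2 * (Im (z' t2) - Im (z t2))).
    lra. }
  assert (HL := eq_trans L1 (eq_trans L2 L3)). cbv beta in HL.
  destruct (Hang t1) as [Hw1 [Hr1 _]]; [lra|].
  destruct (Hang t2) as [Hw2 [Hr2 _]]; [lra|].
  rewrite (im_mu_log_is_arg mu _ _ Hw1 Hr1),
    (im_mu_log_is_arg mu _ _ Hw2 Hr2) in HL.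
  rewrite (proj1 (is_arg_upper _ _ Hw1 Hr1)),
    (proj1 (is_arg_upper _ _ Hw2 Hr2)) in HI.
  assert (Hsnell : Im mu <> 0 ->
     s1 * sin theta1 * exp (- (Re mu / Im mu) * theta1) =
     s2 * sin theta2 * exp (- (Re mu / Im mu) * theta2)).
  { intros Hn.
    apply (eliminate_modulus s1 s2 (Re mu) (Im mu)
             (Cmod (z' t1 - z t1)) (Cmod (z' t2 - z t2)));
      [apply Cmod_gt_0, Hw1|apply Cmod_gt_0, Hw2|exact Hn|exact HI|exact HL]. }
  assert (Hnz : ~ (Re mu = 0 /\ Im mu = 0)).
  { intros [E1 E2]. apply Hmu. destruct mu as [m n]. simpl in E1, E2.
    rewrite E1, E2. reflexivity. }
  split; [exact Hsnell|split].
  - intros Hn. rewrite Hn in HL.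
    apply (Rmult_eq_reg_l (Re mu)); [unfold theta1, theta2; lra|].
    intros Hm. apply Hnz. split; assumption.
  - intros Hm.
    assert (Hn : Im mu <> 0) by (intros Hn; apply Hnz; split; assumption).
    specialize (Hsnell Hn). rewrite Hm in Hsnell.
    replace (- (0 / Im mu)) with 0 in Hsnell by (field; exact Hn).
    rewrite !Rmult_0_l, exp_0, !Rmult_1_r in Hsnell. exact Hsnell.
Qed.
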